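(* Let $p$ be a prime and $b\in(0,1)$, and let $\{X_n\}_{n\in\mathbb{N}_0}$ be the process $$X_n=\sum_{k=0}^\infty b^k\sum_{j=1}^{p^{k+1}-1}\mathbf{1}_{\{J_k=j\}}\sum_{m=1}^{jn}Y_k^j(m),\quad n\in\mathbb{N}_0,$$ constructed in the context from a random vector $\mathbf u=(u_0,\dots,u_{p-1})$ with $u_0+\dots+u_{p-1}=0$. Then $\{X_n\}_{n\in\mathbb{N}_0}$ is dt-ss-si with scaling function $b(n)=(|n|_p)^H$, where $H=-\log_p(b)$.
   Context: $\mathbb{N}=\{1,2,\dots\}$, $\mathbb{N}_0=\{0,1,2,\dots\}$; $\overset{d}{=}$ denotes equality in distribution; $|n|_p=p^{-v_p(n)}$ is the $p$-adic norm; the scaling function $b(\cdot)$ is distinct from the number $b$. Construction. Fix a prime $p$ and $b\in(0,1)$. Let $\mathbf u=(u_0,\dots,u_{p-1})$ be a $p$-dimensional real random vector whose entries sum up to $0$. For $k\in\mathbb{N}_0$ define the process $\{V_k(n)\}_{n\in\mathbb{N}_0}$ by $V_k(n)=0$ if $p^k\nmid n$, and $V_k(n)=u_s$ if $n\equiv sp^k\pmod{p^{k+1}}$, $s\in\{0,\dots,p-1\}$. Let $\{U_k^j\}_{k\in\mathbb{N}_0,\,1\leq j\leq p^{k+1}-1}$ be independent random variables, with $U_k^j$ uniformly distributed on $\{0,1,\dots,p^{k+1}-1\}$, this family being independent of $\mathbf u$. Put $Y_k^j(n)=V_k(n+U_k^j)$, $n\in\mathbb{N}_0$. Let $\{J_k\}_{k\in\mathbb{N}_0}$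 be independent random variables, $J_k$ uniform on $\{0,1,\dots,p^{k+1}-1\}$, independent of $\mathbf u$ and $\{U_k^j\}$. With $Y_{k,j}(n)=\sum_{m=j(n-1)+1}^{jn}Y_k^j(m)$ for $n\in\mathbb N$, define $$X_n=\sum_{k=0}^\infty b^k\sum_{\ell=1}^n\sum_{j=1}^{p^{k+1}-1}\mathbf{1}_{\{J_k=j\}}Y_{k,j}(\ell)=\sum_{k=0}^\infty b^k\sum_{j=1}^{p^{k+1}-1}\mathbf{1}_{\{J_k=j\}}\sum_{m=1}^{jn}Y_k^j(m),$$ which converges almost surely. A real-valued process $\{X_m\}_{m\in\mathbb{N}_0}$ is dt-ss-si with scaling function $b(\cdot):\mathbb N\to(0,\infty)$ if $\{X_{nm}\}_{m\in\mathbb{N}_0}\overset{d}{=}\{b(n)X_m\}_{m\in\mathbb{N}_0}$ for every $n\in\mathbb{N}$, and $\{X_{m+1}-X_m\}_{m\in\mathbb{N}_0}\overset{d}{=}\{X_{m+k+1}-X_{m+k}\}_{m\in\mathbb{N}_0}$ for every $k\in\mathbb{N}$. *)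

(* Defs.v *)
From mathcomp Require Import all_boot all_order all_algebra.
From mathcomp Require Import all_classical all_reals all_analysis.

Set Implicit Arguments.
Unset Strict Implicit.
Unset Printing Implicit Defensive.

Import Order.TTheory GRing.Theory Num.Theory.
Import numFieldNormedType.Exports.

Local Open Scope classical_set_scope.
Local Open Scope ring_scope.

Definition sigma_gen (Omega I : Type) (d : measure_display)
    (S : measurableType d) (D : set I) (Z : I -> Omega -> S) :
    set (set Omega) :=
  <<s \bigcup_(i in D) preimage_set_system setT (Z i) measurable >>.

Section independence.
Context (d : measure_display) (T : measurableType d) (R : realType).
Variable P : probability T R.

Definition independent_systems (F G : set (set T)) : Prop :=
  forall A B, F A -> G B -> (P (A `&` B) = P A * P B)%E.

Definition mutually_independent (I : choiceType) (d' : measure_display)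
    (S : measurableType d') (D : set I) (Z : I -> T -> S) : Prop :=
  forall (s : seq I) (B : I -> set S),
    uniq s -> (forall i, i \in s -> D i) ->
    (forall i, i \in s -> measurable (B i)) ->
    (P (\bigcap_(i in [set` s]) (Z i @^-1` B i)) =
     \prod_(i <- s) P (Z i @^-1` B i))%E.

Definition uniform_below (N : nat) (Z : T -> nat) : Prop :=
  forall i : nat, (i < N)%N -> P (Z @^-1` [set i]) = (N%:R^-1)%:E.

End independence.

Section processes.
Context (d : measure_display) (T : measurableType d) (R : realType).
Variable P : probability T R.

(* The product sigma-algebra on R^nat, generated by the coordinate maps. *)
Definition path_sigma : set (set (nat -> R)) :=
  sigma_gen setT (fun (n : nat) (x : nat -> R) => x n).

Definition process (X : nat -> T -> R) : Prop :=
  forall n, measurable_fun setT (X n).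

Definition eq_in_distribution (X Y : nat -> T -> R) : Prop :=
  forall A : set (nat -> R), path_sigma A ->
    P [set w | A (X ^~ w)] = P [set w | A (Y ^~ w)].

(* The scaling function is defined on {1, 2, ...}; its value at 0 is
   irrelevant. *)
Definition dt_ss_si (X : nat -> T -> R) (bfun : nat -> R) : Prop :=
  [/\ process X,
      forall n : nat, (0 < n)%N -> 0 < bfun n,
      forall n : nat, (0 < n)%N ->
        eq_in_distribution (fun m w => X (n * m)%N w)
                           (fun m w => bfun n * X m w)
    & forall k : nat, (0 < k)%N ->
        eq_in_distribution (fun m w => X m.+1 w - X m w)
                           (fun m w => X (m + k).+1%N w - X (m + k)%N w)].

End processes.

Section construction.
Context (R : realType) (p : nat).

(* p ^ (- v_p n), for n > 0; the value at n = 0 is junk, as logn p 0 = 0. *)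
Definition padic_norm (n : nat) : R := p%:R ^- logn p n.

(* When p ^ k divides n, the sum has exactly one term. *)
Definition V (u : 'I_p -> R) (k n : nat) : R :=
  if (p ^ k %| n)%N
  then \sum_(s < p | n == s * p ^ k %[mod p ^ k.+1]) u s
  else 0.

Context (T : Type) (b : R) (u : 'I_p -> T -> R).
Variables (U : nat -> nat -> T -> nat) (J : nat -> T -> nat).

Definition Y (k j n : nat) (w : T) : R := V (u ^~ w) k (n + U k j w)%N.

Definition X_term (n : nat) (w : T) (k : nat) : R :=
  b ^+ k * \sum_(1 <= j < (p ^ k.+1)%N)
             \1_(J k @^-1` [set j]) w * \sum_(1 <= m < ((j * n).+1)%N) Y k j m w.

Definition X (n : nat) (w : T) : R := limn (series (X_term n w)).

Definition U_index : set (nat * nat) :=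
  [set kj | (1 <= kj.2 <= p ^ kj.1.+1 - 1)%N].

End construction.

(* Main.v *)
From HB Require Import structures.
Require Import Defs.
From mathcomp Require Import all_boot all_order all_algebra.
From mathcomp Require Import all_classical all_reals all_analysis.
From mathcomp Require Import measurable_realfun zify ring.

(** Put [N_k = p ^ k.+1].  At each level [k] the process uses only one of the
variables [U k j], the one with [j = J k].  Hence [X] is a fixed measurable
functional ([walk]) of the vector [u] and of the sequence of pairs
[Z_k = (J_k, U_k ^ (max 1 J_k))].  Replacing the index [0], which lies
outside the family, by [1] is harmless because a level with [J_k = 0]
contributes nothing, and it makes the law of the data very simple: the pairs [Z_k] are
independent of one another and of [u], and [Z_k] is uniform on the square
[{0, .., N_k - 1} ^ 2] ([joint_block_law]).

Everything then reduces to maps of these squares that preserve the uniform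
law.  The level-[k] term is [b ^ k] times the sum of the [N_k]-periodic
sequence [V u k] over a window of length [j * n] that starts after [a], where
[(j, a) = Z_k].

- Increments.  Starting at time [n] instead of [0] moves the window by
  [j * n], which amounts to [(j, a) |-> (j, a + j * n mod N_k)], a rotation of
  each row of the square ([level_shift], [square_law_shift]).

- Scaling by [n = p ^ e * q] with [q] prime to [p].  For [k < e] the window is
  a whole number of periods, over which [V u k] sums to a multiple of
  [\sum_s u s = 0] ([level_low]).  At level [k + e] only the multiples of
  [p ^ e] matter, and [V u (k + e) (p ^ e * m) = V u k m], so that the term is
  the level-[k] term for the pair [(j * q mod N_k, a div p ^ e)]
  ([level_high]).  This map sends the uniform law of the square of side
  [N_(k + e)] to that of side [N_k] ([square_law_fold]).  The shift of levels
  leaves the factor [b ^ e], which is the [H]-th power of [p ^ - e].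

A law on the space of all data [(u, Z)] is determined by its values on finite
cylinders, and there it is a product; so a level-wise map that preserves the
uniform laws, possibly with a shift of the levels, preserves the joint law
([sample_invariant]), hence also the law of every process computed from the
data.  No limit of laws is needed: the series that defines [walk] converges
at every point of the data space, since a window of length [j * n] with
[j < N_k] meets at most [n] periods. *)

Set Implicit Arguments.
Unset Strict Implicit.
Unset Printing Implicit Defensive.

Import Order.TTheory GRing.Theory Num.Theory.
Import numFieldNormedType.Exports.

Local Open Scope classical_set_scope.
Local Open Scope ring_scope.

(** * Sums over residues *)

Section residues.
Context (G : zmodType).
Implicit Types (h : nat -> G) (N : nat).

Lemma sum_modn_perm h N (g : nat -> nat) :
  (forall i j, (i < N)%N -> (j < N)%N -> g i = g j %[mod N] -> i = j) ->
  \sum_(i < N) h (g i %% N)%N = \sum_(i < N) h i.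
Proof.
case: N => [|N] ginj; first by rewrite !big_ord0.
pose f (i : 'I_N.+1) := Ordinal (ltn_pmod (g i) (ltn0Sn N)).
rewrite [RHS](reindex_inj (h := f)) => [|i j /(congr1 val) /= gij].
  exact: eq_bigr.
by apply: val_inj; exact: (ginj _ _ (ltn_ord i) (ltn_ord j) gij).
Qed.

Lemma sum_modn_shift h N c :
  \sum_(i < N) h ((i + c) %% N)%N = \sum_(i < N) h i.
Proof.
apply: (sum_modn_perm h (g := addn^~ c)) => i j iN jN /eqP.
by rewrite eqn_modDr !modn_small// => /eqP.
Qed.

Lemma sum_modn_mul h N q : coprime N q ->
  \sum_(i < N) h ((i * q) %% N)%N = \sum_(i < N) h i.
Proof.
move=> Nq; apply: (sum_modn_perm h (g := muln^~ q)) => i j.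
wlog ij : i j / (i <= j)%N => [wl iN jN e|iN jN /esym/eqP].
  by case/orP: (leq_total i j) => le; [|symmetry]; exact: wl.
rewrite eqn_mod_dvd ?leq_mul2r ?ij ?orbT// -mulnBl Gauss_dvdl//.
rewrite -eqn_mod_dvd// !modn_small// => /eqP //.
Qed.

Lemma sum_mul_divn (h : nat -> nat -> G) M N : (0 < N)%N ->
  \sum_(i < M * N) h (i %/ N)%N (i %% N)%N = \sum_(i < M) \sum_(j < N) h i j.
Proof.
move=> N0; elim: M => [|M IH]; first by rewrite mul0n !big_ord0.
rewrite [in RHS]big_ord_recr /= -IH mulSn addnC big_split_ord /=; congr (_ + _).
by apply: eq_bigr => j _; rewrite divnMDl// modnMDl divn_small// modn_small// addn0.
Qed.

Lemma sum_divn h M N : (0 < N)%N ->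
  \sum_(i < M * N) h (i %/ N)%N = (\sum_(i < M) h i) *+ N.
Proof.
move=> N0; rewrite (sum_mul_divn (fun i _ => h i))// -sumrMnl.
by apply: eq_bigr => i _; rewrite sumr_const card_ord.
Qed.

Lemma sum_modn h M N : (0 < N)%N ->
  \sum_(i < M * N) h (i %% N)%N = (\sum_(i < N) h i) *+ M.
Proof.
by move=> N0; rewrite (sum_mul_divn (fun _ j => h j))// sumr_const card_ord.
Qed.

End residues.

(** * Window sums of the periodic sequences *)

Section windows.
Context (R : realType) (p : nat) (p_prime : prime p).
Implicit Types (u : 'I_p -> R) (k a e M n : nat).

Let p_gt0 : (0 < p)%N. Proof. exact: prime_gt0. Qed.
Let pX_gt0 k : (0 < p ^ k)%N. Proof. by rewrite expn_gt0 p_gt0. Qed.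

(** A residue of the form [s * p ^ k] modulo [p ^ k.+1] forces [p ^ k] to
divide [n]: the case distinction in [V] is absorbed by the index condition. *)
Lemma V_residue u k n :
  V u k n = \sum_(s < p | (n %% p ^ k.+1)%N == (s * p ^ k)%N) u s.
Proof.
have sE (s : 'I_p) : ((s * p ^ k) %% p ^ k.+1 = s * p ^ k)%N.
  by rewrite modn_small// expnS ltn_pmul2r.
rewrite /V; case: ifPn => [_|/negP pkn].
  by apply: eq_bigl => s; rewrite sE.
rewrite big_pred0// => s; apply: contra_notF pkn => /eqP ns.
by rewrite (divn_eq n (p ^ k.+1)) ns dvdn_add// dvdn_mull// ?expnS ?dvdn_mull.
Qed.

Lemma V_mod u k n : V u k (n %% p ^ k.+1) = V u k n.
Proof. by rewrite !V_residue modn_mod. Qed.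

Lemma V_dilate u k e n : V u (k + e) (p ^ e * n) = V u k n.
Proof.
rewrite !V_residue; apply: eq_bigl => s.
by rewrite (addnC k) -addnS !expnD -muln_modr mulnCA eqn_pmul2l.
Qed.

Lemma V_ndvd u k e n : ~~ (p ^ e %| n)%N -> V u (k + e) n = 0.
Proof.
move=> pen; rewrite /V ifN//; apply: contra pen; apply: dvdn_trans.
by rewrite dvdn_exp2l// leq_addl.
Qed.

Lemma V_sum_period u k a :
  \sum_(i < p ^ k.+1) V u k (i + a) = \sum_(s < p) u s.
Proof.
under eq_bigr do rewrite -V_mod.
rewrite sum_modn_shift.
under eq_bigr => i _ do rewrite V_residue big_mkcond.
rewrite exchange_big; apply: eq_bigr => s _ /=.
have sk : (s * p ^ k < p ^ k.+1)%N by rewrite expnS ltn_pmul2r.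
rewrite (bigD1 (Ordinal sk))//= modn_small// eqxx big1 ?addr0// => i neq.
by rewrite modn_small// ifN//; apply: contra neq => /eqP e; exact/eqP/val_inj.
Qed.

Lemma ler_norm_V u k n : `|V u k n| <= V (fun s => `|u s|) k n.
Proof. by rewrite !V_residue ler_norm_sum. Qed.

Definition window u k a M : R := \sum_(i < M) V u k (i.+1 + a).

Lemma window0 u k a : window u k a 0 = 0.
Proof. by rewrite /window big_ord0. Qed.

Lemma window_add u k a M n :
  window u k a (M + n) = window u k a M + window u k (a + M) n.
Proof.
rewrite /window big_split_ord /=; congr (_ + _).
by apply: eq_bigr => i _; rewrite addnC addnS [in RHS]addnC addnS addnA.
Qed.

Lemma window_mod u k a M : window u k (a %% p ^ k.+1) M = window u k a M.
Proof.
by apply: eq_bigr => i _; rewrite -V_mod modnDmr V_mod.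
Qed.

Lemma window_period u k a n :
  window u k a (n * p ^ k.+1) = (\sum_(s < p) u s) *+ n.
Proof.
elim: n => [|n IH] in a *; first by rewrite mul0n window0.
rewrite mulSn window_add IH mulrS; congr (_ + _).
by rewrite -[RHS](V_sum_period u k a.+1); apply: eq_bigr => i _; rewrite addSnnS.
Qed.

(** Full periods contribute multiples of [\sum_s u s], so the length of a window
counts only modulo the period. *)
Lemma window_modr u k a M : \sum_(s < p) u s = 0 ->
  window u k a (M %% p ^ k.+1) = window u k a M.
Proof.
move=> u0; rewrite [in RHS](divn_eq M (p ^ k.+1)) window_add window_period u0.
by rewrite mul0rn add0r -[RHS]window_mod addnC modnMDl window_mod.
Qed.

(** Each run of [p ^ e] consecutive integers contains exactly one multiple of
[p ^ e], and the other integers are zeros of [V u (k + e)]. *)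
Lemma window_dilate u k e a M :
  window u (k + e) a (p ^ e * M) = window u k (a %/ p ^ e) M.
Proof.
elim: M => [|M IH]; first by rewrite muln0 !window0.
rewrite -[in RHS]addn1 mulnSr !window_add IH; congr (_ + _).
rewrite {2}/window big_ord1 /window.
have ra : (a %% p ^ e < p ^ e)%N by rewrite ltn_mod.
(* The multiple of [p ^ e] occurs at the offset that completes the residue of
   [a] to [p ^ e]; the successor comes from windows starting after [a]. *)
have r1 : (p ^ e - (a %% p ^ e).+1 < p ^ e)%N by rewrite ltn_subrL pX_gt0.
have E i : (i.+1 + (a + p ^ e * M) =
    (a %/ p ^ e + M) * p ^ e + (i + (a %% p ^ e).+1))%N.
  by have := divn_eq a (p ^ e); rewrite mulnDl (mulnC (p ^ e)%N M); lia.
rewrite (bigD1 (Ordinal r1))//= big1 ?addr0 => [|i ir].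
  by rewrite E subnK// -mulSnr mulnC V_dilate add1n.
rewrite E; apply: V_ndvd; rewrite dvdn_addr ?dvdn_mull//.
apply: contra ir => /dvdnP[q qE]; apply/eqP/val_inj => /=.
have q1 : q = 1%N.
  have lt2 : (q * p ^ e < 2 * p ^ e)%N.
    by rewrite -qE mul2n -addnn -addSn leq_add.
  move: lt2; rewrite ltn_pmul2r//; case: q qE => [|[|]]//.
  by rewrite mul0n addnS.
by apply/eqP; rewrite -(eqn_add2r (a %% p ^ e).+1) subnK// qE q1 mul1n.
Qed.

Lemma ler_norm_window u k a M : `|window u k a M| <= window (fun s => `|u s|) k a M.
Proof.
by apply: le_trans (ler_norm_sum _ _ _) _; apply: ler_sum => i _; exact: ler_norm_V.
Qed.

(** Comparing with the sequence built from the [`|u s|] makes window sums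
monotone in the length, so that the bound follows from the full periods. *)
Lemma window_bound u k a M n : (M <= n * p ^ k.+1)%N ->
  `|window u k a M| <= (\sum_(s < p) `|u s|) *+ n.
Proof.
move=> Mn; apply: le_trans (ler_norm_window _ _ _ _) _.
rewrite -(window_period _ k a) -(subnKC Mn) window_add lerDl.
by apply: sumr_ge0 => i _; rewrite V_residue sumr_ge0.
Qed.

End windows.

(** * Countable intersections and uniform variables *)

Lemma sigma_algebra_forall (T : Type) (G : set (set T)) (I : countType)
    (Q : I -> set T) :
  sigma_algebra setT G -> (forall i, G (Q i)) -> G [set w | forall i, Q i w].
Proof.
move=> [G0 GC GU] GQ.
pose F n : set T := if unpickle n is Some i then Q i else setT.
have GF n : G (setT `\` F n).
  by rewrite /F; case: unpickle => [i|]; [exact: GC|rewrite setDv].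
have -> : [set w | forall i, Q i w] = setT `\` \bigcup_n (setT `\` F n).
  apply/seteqP; split => [w Qw|w [_ NU] i].
    split=> // -[n _ [_]]; apply; rewrite /F.
    by case: unpickle => [i|//]; exact: Qw.
  apply: contrapT => NQ; apply: NU; exists (pickle i) => //.
  by split=> //; rewrite /F pickleK.
exact/GC/GU.
Qed.

Section uniform_law.
Context (d : measure_display) (T : measurableType d) (R : realType).
Variable P : probability T R.

(** The masses [1 / N] of the values below [N] add up to [1], so the event that
[Z] takes another value is negligible. *)
Lemma uniform_total_probability N (Z : {RV P >-> nat}) (A : set T) :
  (0 < N)%N -> uniform_below P N Z -> measurable A ->
  P A = (\sum_(i < N) P (A `&` Z @^-1` [set (i : nat)]))%E.
Proof.
move=> N0 Zunif mA.
have mZ (i : nat) : measurable (Z @^-1` [set i]) by exact: measurable_funPTI.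
have tZ : trivIset setT (fun i : 'I_N => Z @^-1` [set (i : nat)]).
  by move=> i j _ _ [w [/= -> /ord_inj]].
pose D := \big[setU/set0]_(i < N) (Z @^-1` [set (i : nat)]).
have mD : measurable D by exact: bigsetU_measurable.
have PD : P D = 1%E.
  rewrite /D measure_bigsetU_ord// (eq_bigr (fun=> (N%:R^-1)%:E)) => [|i _].
    rewrite sumEFin sumr_const card_ord -[X in X%:E]mulr_natl divff//.
    by rewrite pnatr_eq0 -lt0n.
  exact/Zunif/ltn_ord.
have mDC : measurable (~` D) by exact: measurableC.
have PDC0 : P (~` D) = 0%E by rewrite probability_setC// PD subee.
have PDC : P (A `&` ~` D) = 0%E.
  apply/eqP; rewrite eq_le measure_ge0 andbT -PDC0.
  by apply: le_measure; rewrite ?inE//; exact: measurableI.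
have -> : P A = (P (A `&` ~` D) + P (A `&` D))%E.
  by rewrite -setDE; exact: measureDI.
rewrite PDC add0e /D big_distrr/=.
by rewrite measure_bigsetU_ord// => [i|]; [exact: measurableI|exact: trivIset_setIl].
Qed.

Lemma uniform_belowE N (Z : {RV P >-> nat}) (D : set nat) :
  (0 < N)%N -> uniform_below P N Z ->
  P (Z @^-1` D) = (N%:R^-1 * \sum_(i < N) \1_D (i : nat))%:E.
Proof.
move=> N0 Zunif.
have mZ (E : set nat) : measurable (Z @^-1` E) by exact: measurable_funPTI.
rewrite (uniform_total_probability N0 Zunif)// mulr_sumr -sumEFin.
apply: eq_bigr => i _; rewrite indicE; case: (boolP (_ \in D)) => [/set_mem Di|Di].
  rewrite mulr1 -(Zunif _ (ltn_ord i)); congr (P _); apply/seteqP.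
  by split => [w []//|w /= Zw]; split => //; rewrite /preimage /= Zw.
rewrite mulr0; transitivity (P set0); last exact: measure0.
congr (P _); apply/seteqP; split => // w [/= Dw Zw].
by move: Di; rewrite notin_setE -Zw.
Qed.

End uniform_law.

(** * Uniform law on a square *)

Section square_law.
Context (R : realType).

Lemma indic_comp (A B : Type) (f : A -> B) (C : set B) (x : A) :
  \1_[set y | C (f y)] x = \1_C (f x) :> R.
Proof. by rewrite !indicE; congr (_%:R); apply/idP/idP; rewrite !inE. Qed.

(** Mass that the uniform law on the square of side [N] gives to the part of
[C] in the row [j]. *)
Definition row_law N (C : set (nat * nat)) (j : nat) : R :=
  N%:R^-1 * (N%:R^-1 * \sum_(a < N) \1_C (j, a : nat)).

Definition square_law N (C : set (nat * nat)) : R :=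
  \sum_(j < N) row_law N C j.

Lemma row_law_ge0 N C j : 0 <= row_law N C j.
Proof.
by rewrite !mulr_ge0 ?invr_ge0// sumr_ge0// => a _; rewrite indicE.
Qed.

Lemma square_law_ge0 N C : 0 <= square_law N C.
Proof. by apply: sumr_ge0 => j _; exact: row_law_ge0. Qed.

Lemma square_lawT N : (0 < N)%N -> square_law N setT = 1.
Proof.
move=> N0; have N1 : (N%:R : R) != 0 by rewrite pnatr_eq0 -lt0n.
rewrite /square_law (eq_bigr (fun=> N%:R^-1)) => [|j _].
  by rewrite sumr_const card_ord -[LHS]mulr_natl divff.
rewrite /row_law (eq_bigr (fun=> 1)) => [|a _]; last by rewrite indicT.
by rewrite sumr_const card_ord mulVf// mulr1.
Qed.

Lemma square_law_shift N (c : nat -> nat) (C : set (nat * nat)) :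
  square_law N [set x | C (x.1, (x.2 + c x.1) %% N)%N] = square_law N C.
Proof.
apply: eq_bigr => j _; rewrite /row_law; congr (_ * (_ * _)).
under eq_bigr do rewrite indic_comp/=.
exact: (sum_modn_shift (fun a => \1_C (j : nat, a))).
Qed.

(** Folding [{0, .., D * N - 1}] onto [{0, .., N - 1}], by residues in the first
coordinate and by quotients in the second, is [D]-to-one in each of them;
multiplication by [q] then permutes the residues. *)
Lemma square_law_fold N D q (C : set (nat * nat)) :
  (0 < N)%N -> (0 < D)%N -> coprime N q ->
  square_law (D * N) [set x | C ((x.1 * q) %% N, x.2 %/ D)%N] = square_law N C.
Proof.
move=> N0 D0 Nq; have D1 : (D%:R : R) != 0 by rewrite pnatr_eq0 -lt0n.
have N1 : (N%:R : R) != 0 by rewrite pnatr_eq0 -lt0n.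
pose r j : R := \sum_(a < N) \1_C (j, a : nat).
have colE (j : nat) :
    \sum_(a < D * N) \1_[set x | C ((x.1 * q) %% N, x.2 %/ D)%N] (j, a : nat) =
    r ((j %% N * q) %% N)%N *+ D.
  rewrite (mulnC D) modnMml; under eq_bigr do rewrite indic_comp/=.
  exact: (sum_divn (fun a => \1_C ((j * q) %% N, a)%N : R)).
rewrite /square_law /row_law.
under eq_bigr do rewrite colE.
rewrite -!mulr_sumr (sum_modn (fun j => r ((j * q) %% N)%N *+ D))//.
rewrite sumrMnl (sum_modn_mul r)//.
set S := \sum_(i < N) _; rewrite -mulrnA -(mulr_natl S) !natrM.
by field; rewrite D1 N1.
Qed.

End square_law.

(** * Joint law of the coefficients and of the levels *)

Section block_law.
Context (R : realType) (d : measure_display) (T : measurableType d).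
Context (P : probability T R) (p : nat).
Context (u : 'I_p -> {RV P >-> R}).
Context (U : nat -> nat -> {RV P >-> nat}) (J : nat -> {RV P >-> nat}).
Hypothesis p_prime : prime p.
Hypothesis U_uniform : forall k j : nat, U_index p (k, j) ->
  uniform_below P (p ^ k.+1) (U k j).
Hypothesis U_indep : mutually_independent P (U_index p)
  (fun (kj : nat * nat) (w : T) => U kj.1 kj.2 w).
Hypothesis U_indep_u : independent_systems P
  (sigma_gen (U_index p) (fun (kj : nat * nat) (w : T) => U kj.1 kj.2 w))
  (sigma_gen setT (fun (s : 'I_p) (w : T) => u s w)).
Hypothesis J_uniform : forall k : nat, uniform_below P (p ^ k.+1) (J k).
Hypothesis J_indep :
  mutually_independent P setT (fun (k : nat) (w : T) => J k w).
Hypothesis J_indep_uU : independent_systems P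
  (sigma_gen setT (fun (k : nat) (w : T) => J k w))
  <<s sigma_gen setT (fun (s : 'I_p) (w : T) => u s w) `|`
      sigma_gen (U_index p) (fun (kj : nat * nat) (w : T) => U kj.1 kj.2 w) >>.

(** [maxn 1] keeps the index in the range of the family [U] when [J k w = 0];
the second component is then uniform whatever the value of the first. *)
Definition block (k : nat) (w : T) : nat * nat :=
  (J k w, U k (maxn 1 (J k w)) w).

Let side_gt0 k : (0 < p ^ k.+1)%N.
Proof. by rewrite expn_gt0 prime_gt0. Qed.

Lemma maxn1_index k j : (j < p ^ k.+1)%N -> U_index p (k, maxn 1 j).
Proof.
have : (1 < p ^ k.+1)%N by rewrite -{1}(expn0 p) ltn_exp2l// prime_gt1.
by rewrite /U_index /= => *; lia.
Qed.

Lemma block_preimage k (C : set (nat * nat)) (i : nat) :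
  block k @^-1` C `&` J k @^-1` [set i] =
  U k (maxn 1 i) @^-1` [set a | C (i, a)] `&` J k @^-1` [set i].
Proof.
by apply/seteqP; rewrite /preimage /block;
  split => w /= [Cw Jw]; split => //; move: Cw; rewrite Jw.
Qed.

Lemma measurable_block k (C : set (nat * nat)) : measurable (block k @^-1` C).
Proof.
have -> : block k @^-1` C =
    \bigcup_i (U k (maxn 1 i) @^-1` [set a | C (i, a)] `&` J k @^-1` [set i]).
  rewrite -(eq_bigcupr (fun i _ => block_preimage k C i)).
  by apply/seteqP; split => [w Cw|w [i _ []]//]; exists (J k w).
by apply: bigcup_measurable => i _; apply: measurableI; exact: measurable_funPTI.
Qed.

Let uB (B : 'I_p -> set R) : set T := [set w | forall s, B s (u s w)].

Let sigma_uB (B : 'I_p -> set R) : (forall s, measurable (B s)) ->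
  sigma_gen setT (fun (s : 'I_p) (w : T) => u s w) (uB B).
Proof.
move=> mB; apply: (sigma_algebra_forall (Q := fun s w => B s (u s w))).
  exact: smallest_sigma_algebra.
move=> s; apply: sub_sigma_algebra; exists s => //.
by exists (B s) => //; rewrite setTI.
Qed.

Lemma measurable_u_cylinder (B : 'I_p -> set R) :
  (forall s, measurable (B s)) -> measurable (uB B).
Proof.
move=> mB; apply: (sigma_algebra_forall (Q := fun s w => B s (u s w))).
  exact: sigma_algebra_measurable.
by move=> s; rewrite -[X in measurable X]setTI; exact: measurable_funP.
Qed.

(** Once the values [J l = j l] are prescribed for [l < L], the second components
of the blocks are members of the family [U] at distinct deterministic indices,
and independence applies directly.  The constraints on [J] are then released
one level at a time by summing over the values of [J K]. *)
Section frozen_columns.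
Context (B : 'I_p -> set R) (C : nat -> set (nat * nat)) (L : nat).
Hypothesis mB : forall s, measurable (B s).

Let J_at (j : nat -> nat) : set T := [set w | forall l, (l < L)%N -> J l w = j l].
Let U_in (j : nat -> nat) : set T :=
  [set w | forall l, (l < L)%N -> C l (j l, U l (maxn 1 (j l)) w)].

Let P_J_at j : (forall l, (j l < p ^ l.+1)%N) ->
  P (J_at j) = (\prod_(l < L) (p ^ l.+1)%:R^-1)%:E.
Proof.
move=> jN; have -> : J_at j =
    \bigcap_(l in [set` index_iota 0 L]) (J l @^-1` [set j l]).
  by apply/seteqP; split => w Jw l /=;
    [rewrite mem_index_iota => /Jw|move=> lL; apply: Jw; rewrite /= mem_index_iota].
rewrite (J_indep (B := fun l => [set j l])) ?iota_uniq//.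
rewrite big_mkord -prodEFin; apply: eq_bigr => l _.
exact: J_uniform.
Qed.

Let P_U_in j : (forall l, (j l < p ^ l.+1)%N) ->
  P (U_in j) = (\prod_(l < L)
    ((p ^ l.+1)%:R^-1 * \sum_(a < p ^ l.+1) \1_(C l) (j l, a : nat)))%:E.
Proof.
move=> jN; pose f l := (l, maxn 1 (j l)).
pose D (kj : nat * nat) := [set a | C kj.1 (j kj.1, a)].
have -> : U_in j = \bigcap_(kj in [set` [seq f l | l <- index_iota 0 L]])
    ((fun w => U kj.1 kj.2 w) @^-1` D kj).
  apply/seteqP; split => w.
    by move=> Uw kj /= /mapP[l]; rewrite mem_index_iota => lL ->; exact: Uw.
  move=> Uw l lL; apply: (Uw (f l)); apply/mapP; exists l => //.
  by rewrite mem_index_iota.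
rewrite U_indep.
- rewrite big_map big_mkord -prodEFin; apply: eq_bigr => l _.
  under eq_bigr do rewrite -(indic_comp R (fun a : nat => (j l, a))).
  apply: (uniform_belowE (D (f l))) => //.
  exact/U_uniform/maxn1_index/jN.
- by rewrite map_inj_uniq ?iota_uniq// => l l' [].
- by move=> kj /mapP[l _ ->]; exact/maxn1_index/jN.
- by [].
Qed.

Let P_frozen j : (forall l, (j l < p ^ l.+1)%N) ->
  P (J_at j `&` (U_in j `&` uB B)) =
  ((\prod_(l < L) row_law R (p ^ l.+1) (C l) (j l))%:E * P (uB B))%E.
Proof.
move=> jN.
have sU : sigma_gen (U_index p) (fun (kj : nat * nat) (w : T) => U kj.1 kj.2 w)
    (U_in j).
  apply: (sigma_algebra_forall (Q := fun l w =>
    (l < L)%N -> C l (j l, U l (maxn 1 (j l)) w))).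
    exact: smallest_sigma_algebra.
  move=> l; apply: sub_sigma_algebra.
  exists (l, maxn 1 (j l)); first exact: maxn1_index.
  by exists [set a | (l < L)%N -> C l (j l, a)] => //; rewrite setTI.
have sJ : sigma_gen setT (fun (k : nat) (w : T) => J k w) (J_at j).
  apply: (sigma_algebra_forall (Q := fun l w => (l < L)%N -> J l w = j l)).
    exact: smallest_sigma_algebra.
  move=> l; apply: sub_sigma_algebra; exists l => //.
  by exists [set a | (l < L)%N -> a = j l] => //; rewrite setTI.
rewrite J_indep_uU//; last first.
  have -> : U_in j `&` uB B =
      [set w | forall b : bool, (if b then U_in j else uB B) w].
    apply/seteqP; split => [w [Uw uw] []//|w Uuw].
    by split; [exact: (Uuw true)|exact: (Uuw false)].
  apply: (sigma_algebra_forall (Q := fun b : bool => if b then U_in j else uB B)).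
    exact: smallest_sigma_algebra.
  by case; apply: sub_sigma_algebra; [right|left; exact: sigma_uB].
rewrite U_indep_u//; last exact: sigma_uB.
by rewrite P_J_at// P_U_in// muleA -EFinM -big_split.
Qed.

Let frozen (K : nat) (j : nat -> nat) : set T := uB B `&`
  [set w | forall l, (l < L)%N ->
     C l (block l w) /\ ((K <= l)%N -> J l w = j l)].

Let measurable_frozen K j : measurable (frozen K j).
Proof.
apply: measurableI; first exact: measurable_u_cylinder.
apply: (sigma_algebra_forall (Q := fun l w => (l < L)%N ->
     C l (block l w) /\ ((K <= l)%N -> J l w = j l))).
  exact: sigma_algebra_measurable.
move=> l; case: (ltnP l L) => lL; last first.
  by rewrite [X in measurable X](_ : _ = setT)//; apply/seteqP; split.
case: (leqP K l) => Kl.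
  rewrite [X in measurable X](_ : _ = block l @^-1` C l `&` J l @^-1` [set j l]).
    by apply: measurableI; [exact: measurable_block|exact: measurable_funPTI].
  by apply/seteqP; split => [w /(_ isT)[Cw /(_ isT)]|w [Cw Jw]].
rewrite [X in measurable X](_ : _ = block l @^-1` C l); first exact: measurable_block.
by apply/seteqP; split => [w /(_ isT)[]|w Cw _].
Qed.

Let P_frozen_from K j : (K <= L)%N -> (forall l, (j l < p ^ l.+1)%N) ->
  P (frozen K j) = ((\prod_(l < L)
     if (l < K)%N then square_law R (p ^ l.+1) (C l)
     else row_law R (p ^ l.+1) (C l) (j l))%:E * P (uB B))%E.
Proof.
elim: K j => [|K IH] j KL jN.
  rewrite (eq_bigr (fun l : 'I_L => row_law R (p ^ l.+1) (C l) (j l)))//.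
  rewrite -P_frozen//; congr (P _); rewrite /frozen /block.
  apply/seteqP; split => w.
    move=> [uw CJ]; split; first by move=> l /CJ[_]; apply.
    by split => // l lL; have [+ Jw] := CJ l lL; rewrite Jw.
  by move=> [Jw [Cw uw]]; split => // l lL; split => [|_]; rewrite Jw//; exact: Cw.
pose upd i l := if l == K then i else j l.
(* Prescribing also the value of [J K] leads back to the previous stage, for
   [j] updated at [K]. *)
rewrite (uniform_total_probability (side_gt0 K) (@J_uniform K)) //.
rewrite (eq_bigr (fun i : 'I_(p ^ K.+1) =>
  (\prod_(l < L | l != Ordinal KL)
     (if (l < K.+1)%N then square_law R (p ^ l.+1) (C l)
     else row_law R (p ^ l.+1) (C l) (j l)) * row_law R (p ^ K.+1) (C K) i)%:E
   * P (uB B)))%E => [|i _].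
  rewrite -ge0_sume_distrl => [|i _].
    rewrite sumEFin -mulr_sumr; congr (_%:E * _)%E.
    by rewrite [RHS](bigD1 (Ordinal KL))//= ltnSn mulrC.
  rewrite lee_fin mulr_ge0 ?row_law_ge0// prodr_ge0// => l _.
  by case: ifP => _; [exact: square_law_ge0|exact: row_law_ge0].
transitivity (P (frozen K (upd i))).
  congr (P _); rewrite /frozen /upd; apply/seteqP; split => w.
    move=> [[uw CJ] Jw]; split => // l lL; have [Cw Jl] := CJ l lL.
    by split => //; case: eqVneq => [->//|lK Kl]; apply: Jl; lia.
  move=> [uw CJ]; split; last by have [_ /(_ (leqnn K))] := CJ K KL; rewrite eqxx.
  split => // l lL; have [Cw Jl] := CJ l lL; split => // Kl.
  by rewrite Jl ?ifN//; lia.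
rewrite IH => [||l]; first congr (_%:E * _)%E.
- rewrite (bigD1 (Ordinal KL))//= ltnn /upd eqxx mulrC; congr (_ * _).
  apply: eq_bigr => l lK; have lK' : (l : nat) != K by [].
  by rewrite (negbTE lK'); do 2 case: ifP => //; lia.
- exact: ltnW.
- by rewrite /upd; case: eqVneq => [->|].
Qed.

Lemma joint_block_law :
  P (uB B `&` [set w | forall l, (l < L)%N -> C l (block l w)]) =
  ((\prod_(l < L) square_law R (p ^ l.+1) (C l))%:E * P (uB B))%E.
Proof.
transitivity (P (frozen L (fun=> 0%N))).
  congr (P _); rewrite /frozen; apply/seteqP; split => w [uw Cw]; split => //.
    by move=> l lL; split; [exact: Cw|rewrite leqNgt lL].
  by move=> l /Cw[].
rewrite P_frozen_from//; congr (_%:E * _)%E.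
by apply: eq_bigr => l _; rewrite ltn_ord.
Qed.

End frozen_columns.
End block_law.

(** * Laws of processes and of data *)

Section path_laws.
Context (R : realType) (d : measure_display) (T : measurableType d).

Lemma measurable_path (X : nat -> T -> R) (A : set (nat -> R)) :
  process X -> path_sigma A -> measurable [set w | A (X ^~ w)].
Proof.
move=> mX; rewrite /path_sigma /sigma_gen.
suff H : <<s \bigcup_(i in setT) preimage_set_system setT
    (fun x : nat -> R => x i) measurable >> `<=`
    [set A | measurable [set w | A (X ^~ w)]] by move/H.
apply: smallest_sub => [|_ [n _ [B mB <-]]].
  split => [|B mB|F mF].
  - exact: measurable0.
  - rewrite /= (_ : [set w | _] = ~` [set w | B (X ^~ w)]); first exact: measurableC.
    by apply/seteqP; split => [w []|w] //; split.
  - rewrite /= (_ : [set w | _] = \bigcup_n [set w | F n (X ^~ w)]).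
      by apply: bigcup_measurable => k _; exact: mF.
    by [].
rewrite /= (_ : [set w | _] = X n @^-1` B).
  by rewrite -[X in measurable X]setTI; exact: mX.
by apply/seteqP; split => [w []|w] //; split.
Qed.

Lemma eq_in_distribution_ae (P : probability T R) (X X' : nat -> T -> R) :
  process X -> process X' -> {ae P, forall w, X ^~ w = X' ^~ w} ->
  eq_in_distribution P X X'.
Proof.
move=> mX mX' [N [mN PN0 subN]] A sA.
have mA : measurable [set w | A (X ^~ w)] by exact: measurable_path.
have mA' : measurable [set w | A (X' ^~ w)] by exact: measurable_path.
have le (E F : set T) : measurable E -> measurable F -> E `<=` F `|` N ->
    (P E <= P F)%E.
  move=> mE mF EFN; rewrite -(measureU0 mF mN PN0).
  by apply: le_measure; rewrite ?inE//; exact: measurableU.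
have E w : ~ N w -> X ^~ w = X' ^~ w by move=> Nw; apply: contrapT => /subN.
apply/eqP; rewrite eq_le !le//=.
  by move=> w Aw; have [|/E e] := pselect (N w); [right|left; rewrite /= e].
by move=> w Aw; have [|/E e] := pselect (N w); [right|left; rewrite /= -e].
Qed.

End path_laws.

Section data_space.
Context (R : realType) (p : nat).

Definition pre_data : Type := (('I_p -> R) * (nat -> nat * nat))%type.

Definition cylinder (B : 'I_p -> set R) (C : nat -> set (nat * nat)) :
    set pre_data :=
  [set x | (forall s, B s (x.1 s)) /\ forall k, C k (x.2 k)].

Definition cylinders : set (set pre_data) :=
  [set E | exists B C L, [/\ forall s, measurable (B s),
     forall k, (L <= k)%N -> C k = setT & E = cylinder B C]].

HB.instance Definition _ := Pointed.on pre_data.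

Definition data := g_sigma_algebraType cylinders.

HB.instance Definition _ := Measurable.on data.

Lemma cylinders_setI : setI_closed cylinders.
Proof.
move=> _ _ [B [C [L [mB CT ->]]]] [B' [C' [L' [mB' CT' ->]]]].
exists (fun s => B s `&` B' s), (fun k => C k `&` C' k), (maxn L L'); split.
- by move=> s; exact: measurableI.
- by move=> k; rewrite geq_max => /andP[? ?]; rewrite CT// CT'// setTI.
- apply/seteqP; split => x /=.
    by move=> [[Bx Cx] [Bx' Cx']]; split => i; split.
  by move=> [Bx Cx]; do 2 split; move=> i; [have []:= Bx i|have []:= Cx i
    |have []:= Bx i|have []:= Cx i].
Qed.

Lemma cylindersT : cylinders setT.
Proof.
exists (fun=> setT), (fun=> setT), 0%N; split => //.
by apply/seteqP; split.
Qed.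

Lemma measurable_coefficient (s : 'I_p) :
  measurable_fun setT (fun x : data => x.1 s).
Proof.
move=> _ B mB; rewrite setTI; apply: sub_sigma_algebra.
exists (fun t => if t == s then B else setT), (fun=> setT), 0%N; split => //.
- by move=> t; case: ifP.
- apply/seteqP; split => x; last by move=> [/(_ s)]; rewrite eqxx.
  by move=> Bx; split => // t; case: eqVneq => [->|].
Qed.

Lemma measurable_level (k : nat) (g : nat * nat -> R) :
  measurable_fun setT (fun x : data => g (x.2 k)).
Proof.
move=> _ B mB; rewrite setTI; apply: sub_sigma_algebra.
exists (fun=> setT), (fun l => if l == k then g @^-1` B else setT), k.+1.
split => //.
- by move=> l kl; rewrite ifN// gtn_eqF.
- apply/seteqP; split => x; last by move=> [_ /(_ k)]; rewrite eqxx.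
  by move=> Bx; split => // l; case: eqVneq => [->|].
Qed.

Lemma data_law_unique d (T : measurableType d) (P : probability T R)
    (M M' : T -> data) :
  measurable_fun setT M -> measurable_fun setT M' ->
  (forall E, cylinders E -> P (M @^-1` E) = P (M' @^-1` E)) ->
  forall E : set data, measurable E -> P (M @^-1` E) = P (M' @^-1` E).
Proof.
move=> mM mM' PE E mE.
pose m1 := measure_function_pushforward__canonical__measure_function_Measure P mM.
pose m2 := measure_function_pushforward__canonical__measure_function_Measure P mM'.
rewrite -[LHS]/(m1 E) -[RHS]/(m2 E).
apply: (measure_unique (cylinders : set (set data)) (fun=> setT)) => //.
- exact: cylinders_setI.
- by move=> _; exact: cylindersT.
- by rewrite bigcup_const.
- by move=> _; rewrite /m1 /= /pushforward preimage_setT probability_setT ltry.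
Qed.

End data_space.

(** * The process as a functional of the data *)

Section level_terms.
Context (R : realType) (p : nat) (p_prime : prime p).
Implicit Types (u : 'I_p -> R) (k n m : nat) (z : nat * nat).

(** The guard makes the term zero when the first component is out of range, as in
the construction, where the sum stops at [p ^ k.+1 - 1]; it also gives the
uniform bound [level_bound] at every point of the data space. *)
Definition level u k n z : R :=
  if (z.1 < p ^ k.+1)%N then window u k z.2 (z.1 * n) else 0.

Lemma level_bound u k n z : `|level u k n z| <= (\sum_(s < p) `|u s|) *+ n.
Proof.
rewrite /level; case: ifPn => [zN|_].
  by apply: window_bound => //; rewrite mulnC leq_mul2l ltnW ?orbT.
by rewrite normr0 mulrn_wge0 ?sumr_ge0.
Qed.

Lemma V_linear u k n :
  V u k n = \sum_(s < p) u s * V (fun t => (t == s)%:R : R) k n.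
Proof.
rewrite V_residue// big_mkcond; apply: eq_bigr => s _.
rewrite V_residue//= big_mkcond/= (bigD1 s)//= eqxx big1 ?addr0 => [|t ts].
  by case: ifP; rewrite ?mulr1 ?mulr0.
by rewrite (negbTE ts); case: ifP.
Qed.

(** With the discrete component [z] separated from [u], measurability in the data
becomes immediate. *)
Lemma level_linear u k n z :
  level u k n z = \sum_(s < p) u s * level (fun t => (t == s)%:R) k n z.
Proof.
rewrite /level; case: ifP => _; last by rewrite big1// => s _; rewrite mulr0.
rewrite /window; under eq_bigr do rewrite V_linear.
by rewrite exchange_big/=; apply: eq_bigr => s _; rewrite mulr_sumr.
Qed.

(** The part of a window after its first [z.1 * n] terms is a window with a later
start, and the start counts only modulo the period. *)
Lemma level_shift u k n m z :
  level u k (n + m) z - level u k n z =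
  level u k m (z.1, (z.2 + z.1 * n) %% p ^ k.+1)%N.
Proof.
rewrite /level/=; case: ifP => _; last by rewrite subrr.
by rewrite mulnDr window_add// addrC addKr window_mod.
Qed.

Let p_gt0 : (0 < p)%N. Proof. exact: prime_gt0. Qed.

(** Here [p ^ k.+1] divides the length of the window. *)
Lemma level_low u k e q m z : \sum_(s < p) u s = 0 -> (k < e)%N ->
  level u k (p ^ e * q * m) z = 0.
Proof.
move=> u0 ke; rewrite /level; case: ifP => // _.
rewrite -(window_modr p_prime)//.
have /eqP -> : (z.1 * (p ^ e * q * m) %% p ^ k.+1 == 0)%N.
  by rewrite -/(dvdn _ _) dvdn_mull// -mulnA dvdn_mulr// dvdn_exp2l.
exact: window0.
Qed.

(** [window_dilate] removes the factor [p ^ e], and the remaining length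
[z.1 * q * m] may be reduced modulo the period, hence so may [z.1 * q]. *)
Lemma level_high u k e q m z : \sum_(s < p) u s = 0 ->
  (z.1 < p ^ (k + e).+1)%N ->
  level u (k + e) (p ^ e * q * m) z =
  level u k m ((z.1 * q) %% p ^ k.+1, z.2 %/ p ^ e)%N.
Proof.
move=> u0 zN; rewrite /level zN/= ltn_mod expn_gt0 p_gt0.
rewrite (_ : z.1 * (p ^ e * q * m) = p ^ e * (z.1 * q * m))%N; last by lia.
rewrite window_dilate//.
by rewrite -(window_modr p_prime)// -[RHS]window_modr// modnMml.
Qed.

End level_terms.

Section limit_process.
Context (R : realType) (p : nat) (p_prime : prime p) (b : R).
Hypotheses (b_gt0 : 0 < b) (b_lt1 : b < 1).

Definition level_series (n : nat) (x : data R p) : nat -> R :=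
  series (fun k => b ^+ k * level x.1 k n (x.2 k)).

Definition walk (n : nat) (x : data R p) : R := limn (level_series n x).

Lemma cvg_level_series n x : cvgn (level_series n x).
Proof.
rewrite /level_series; apply: normed_cvg; rewrite /normed_series_of.
pose c := (\sum_(s < p) `|x.1 s|) *+ n.
have c0 : 0 <= c by rewrite mulrn_wge0 ?sumr_ge0.
apply: (series_le_cvg (v_ := geometric c b)) => [k||k|].
- exact: normr_ge0.
- by move=> k; rewrite /= mulr_ge0// exprn_ge0// ltW.
- have bk0 : 0 <= b ^+ k by rewrite exprn_ge0// ltW.
  by rewrite /geometric/= normrM ger0_norm// mulrC ler_wpM2r// level_bound.
- by apply: is_cvg_geometric_series; rewrite ger0_norm// ltW.
Qed.

Lemma measurable_walk n : measurable_fun setT (walk n).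
Proof.
apply: (measurable_fun_cvg (h := fun K x => level_series n x K)) => [K|x _].
  apply: measurable_sum => k.
  under eq_fun do rewrite level_linear//.
  apply: measurable_funM => //; apply: measurable_sum => s.
  apply: measurable_funM; first exact: measurable_coefficient.
  exact: (measurable_level k (level (fun t => (t == s)%:R) k n)).
exact: cvg_level_series.
Qed.

Lemma walk_shift n m x :
  walk (n + m) x - walk n x =
  walk m (x.1, fun k => ((x.2 k).1, ((x.2 k).2 + (x.2 k).1 * n) %% p ^ k.+1)%N).
Proof.
rewrite /walk/level_series -lim_seriesB; [|exact: cvg_level_series..].
by congr (limn (series _)); apply/funext => k /=; rewrite !fctE -mulrBr level_shift.
Qed.

(** The first [e] terms vanish and the others are those of the transformed data,
[e] levels lower. *)
Lemma walk_dilate e q m x : \sum_(s < p) x.1 s = 0 ->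
  (forall k, (x.2 k).1 < p ^ k.+1)%N ->
  walk (p ^ e * q * m) x = b ^+ e *
  walk m (x.1, fun k =>
    (((x.2 (k + e)%N).1 * q) %% p ^ k.+1, (x.2 (k + e)%N).2 %/ p ^ e)%N).
Proof.
move=> u0 xN; set x' := (x.1, _).
have seriesE K : level_series (p ^ e * q * m) x (K + e)%N =
    b ^+ e * level_series m x' K.
  rewrite /level_series /series /=.
  rewrite (big_cat_nat (n := e))/= ?leq_addl// big_nat_cond big1 ?add0r; last first.
    by move=> k /andP[/andP[_ ke] _]; rewrite level_low ?mulr0.
  rewrite -{1}(add0n e) big_addn addnK mulr_sumr; apply: eq_bigr => k _.
  by rewrite level_high// exprD mulrCA mulrA mulrAC.
apply: cvg_lim => //; rewrite -(cvg_shiftn e).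
under eq_fun do rewrite /= seriesE.
by apply: cvgM; [exact: cvg_cst|exact: cvg_level_series].
Qed.

End limit_process.

(** * Invariance under maps that preserve the uniform laws *)

Section invariance.
Context (R : realType) (d : measure_display) (T : measurableType d).
Context (P : probability T R) (p : nat).
Context (u : 'I_p -> {RV P >-> R}).
Context (U : nat -> nat -> {RV P >-> nat}) (J : nat -> {RV P >-> nat}).
Hypothesis p_prime : prime p.
(* The joint law of the blocks, supplied by [joint_block_law], is all that
   matters from here on. *)
Hypothesis joint_law : forall (B : 'I_p -> set R) C L,
  (forall s, measurable (B s)) ->
  P ([set w | forall s, B s (u s w)] `&`
     [set w | forall l, (l < L)%N -> C l (block U J l w)]) =
  ((\prod_(l < L) square_law R (p ^ l.+1) (C l))%:E *
   P [set w | forall s, B s (u s w)])%E.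

(** The shift [e] serves the scaling, where the levels below [e] disappear. *)
Definition sample (e : nat) (tau : nat -> nat * nat -> nat * nat) (w : T) :
    data R p :=
  (u ^~ w, fun k => tau k (block U J (k + e) w)).

(* The condition that a cylinder imposes on [sample e tau], expressed on the
   original blocks: the first [e] levels are unconstrained. *)
Let pulled e (tau : nat -> nat * nat -> nat * nat) (C : nat -> set (nat * nat)) l :=
  if (l < e)%N then setT else tau (l - e)%N @^-1` C (l - e)%N.

Let sample_cylinder e tau B C L : (forall k, (L <= k)%N -> C k = setT) ->
  sample e tau @^-1` cylinder B C =
  [set w | forall s, B s (u s w)] `&`
     [set w | forall l, (l < L + e)%N ->
        pulled e tau C l (block U J l w)].
Proof.
move=> CT; apply/seteqP; split => w /= [uw Cw]; split => //.
  move=> l lL; rewrite /pulled; case: ltnP => // el; rewrite /preimage /=.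
  by have := Cw (l - e)%N; rewrite /= subnK.
move=> k; have [kL|/CT ->//] := ltnP k L.
have := Cw (k + e)%N; rewrite ltn_add2r => /(_ kL).
by rewrite /pulled ltnNge leq_addl/= addnK.
Qed.

Lemma measurable_sample e tau : measurable_fun setT (sample e tau).
Proof.
apply: (measurability (@cylinders R p : set (set (data R p)))) => //.
move=> _ [_ [B [C [L [mB CT ->]]]] <-]; rewrite setTI.
rewrite (sample_cylinder _ _ _ (L := L))//.
apply: measurableI; first exact: measurable_u_cylinder.
apply: (sigma_algebra_forall (Q := fun l w => (l < L + e)%N ->
        pulled e tau C l (block U J l w))).
  exact: sigma_algebra_measurable.
move=> l; apply: (measurable_block U J l [set z | (l < L + e)%N ->
        pulled e tau C l z]).
Qed.

(** On a cylinder the joint law is a product: the first [e] factors are [1] and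
the factor of level [k + e] is that of level [k] by the assumption on
[tau]. *)
Lemma sample_invariant e tau (F : nat -> data R p -> R) :
  (forall k C, square_law R (p ^ (k + e).+1) (tau k @^-1` C) =
               square_law R (p ^ k.+1) C) ->
  (forall n, measurable_fun setT (F n)) ->
  eq_in_distribution P (fun n w => F n (sample e tau w))
                       (fun n w => F n (sample 0 (fun=> id) w)).
Proof.
move=> tau_law mF A sA.
pose E := [set x | A (F ^~ x)].
apply: (data_law_unique (M := sample e tau) (M' := sample 0 (fun=> id))
  _ _ _ (E := E)).
- exact: measurable_sample.
- exact: measurable_sample.
- move=> _ [B [C [L [mB CT ->]]]].
  rewrite !(sample_cylinder _ _ _ (L := L))// !joint_law//; congr (_%:E * _)%E.
  rewrite /pulled addn0 addnC big_split_ord /= big1 ?mul1r => [|k _].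
    apply: eq_bigr => k _.
    by rewrite ltnNge leq_addr/= addKn subn0 addnC tau_law.
  by rewrite ltn_ord square_lawT// expn_gt0 prime_gt0.
- exact: measurable_path.
Qed.

End invariance.

(** * Scaling and stationarity of the increments *)

Section process_as_walk.
Context (R : realType) (d : measure_display) (T : measurableType d).
Context (P : probability T R) (p : nat) (b : R).
Context (u : 'I_p -> {RV P >-> R}).
Context (U : nat -> nat -> {RV P >-> nat}) (J : nat -> {RV P >-> nat}).

(** The indicators select the single index [j = J k w], if it is in range.  For
[J k w = 0] both sides vanish: the window on the right is empty. *)
Lemma X_term_level n w k :
  X_term b (fun s w => u s w) (fun k j w => U k j w) (fun k w => J k w) n w k =
  b ^+ k * level (u ^~ w) k n (block U J k w).
Proof.
rewrite /X_term /=; congr (_ * _); rewrite /level /=.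
have YE j : \sum_(1 <= m < (j * n).+1) Y (fun s w => u s w)
    (fun k j w => U k j w) k j m w = window (u ^~ w) k (U k j w) (j * n).
  by rewrite big_add1 big_mkord.
have zero j : j <> J k w -> \1_(J k @^-1` [set j]) w = 0 :> R.
  by move=> jJ; rewrite indicE memNset// => /esym.
case: (ltnP (J k w) (p ^ k.+1)) => JN; last first.
  rewrite big_nat_cond big1// => j /andP[/andP[_ jN] _].
  by rewrite zero ?mul0r// => jJ; move: jN; rewrite jJ ltnNge JN.
have [J0|J0] := posnP (J k w).
  rewrite J0 mul0n window0 big_nat_cond big1// => j /andP[/andP[j0 _] _].
  by rewrite zero ?mul0r// => jJ; move: j0; rewrite jJ J0.
rewrite (bigD1_seq (J k w))/= ?iota_uniq ?mem_index_iota ?J0//.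
rewrite [X in _ + X]big1 ?addr0 => [|j /eqP jJ]; last by rewrite zero ?mul0r.
by rewrite indicE mem_set// mul1r YE (maxn_idPr J0).
Qed.

Lemma X_walk n w :
  X b (fun s w => u s w) (fun k j w => U k j w) (fun k w => J k w) n w =
  walk b n (sample u U J 0 (fun=> id) w).
Proof.
rewrite /X /walk /level_series /sample; congr (limn (series _)).
by apply/funext => k; rewrite X_term_level /= addn0.
Qed.

Hypothesis p_gt0 : (0 < p)%N.
Hypothesis J_uniform : forall k : nat, uniform_below P (p ^ k.+1) (J k).

Lemma ae_J_lt : {ae P, forall w, forall k, (J k w < p ^ k.+1)%N}.
Proof.
have J_ge0 k : P (J k @^-1` [set i | (p ^ k.+1 <= i)%N]) = 0%E.
  rewrite (uniform_belowE (N := p ^ k.+1))// ?expn_gt0 ?p_gt0//.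
  rewrite big1 ?mulr0// => i _; rewrite indicE memNset//=.
  by rewrite leqNgt ltn_ord.
apply/ae_foralln => k; exists (J k @^-1` [set i | (p ^ k.+1 <= i)%N]); split.
- exact: measurable_funPTI.
- exact: J_ge0.
- by move=> w /= /negP; rewrite -leqNgt.
Qed.

End process_as_walk.

(** [p `^ (ln b / ln p) = b], raised to the power [logn p n]. *)
Lemma padic_norm_powR (R : realType) (p : nat) (b : R) n :
  (1 < p)%N -> 0 < b ->
  padic_norm R p n `^ (- (ln b / ln p%:R)) = b ^+ logn p n.
Proof.
move=> p1 b0; have p0 : 0 < (p%:R : R) by rewrite ltr0n ltnW.
have lnp : ln (p%:R : R) != 0 by rewrite gt_eqF// ln_gt0// ltr1n.
have px0 : 0 < (p%:R ^+ logn p n : R) by rewrite exprn_gt0.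
rewrite /padic_norm /powR gt_eqF ?invr_gt0// lnV ?posrE// lnXn// mulrNN.
by rewrite mulrnAr divfK// -mulr_natr expRM_natr lnK ?posrE.
Qed.

Theorem proposition4p6 (R : realType) (d : measure_display)
    (T : measurableType d) (P : probability T R) (p : nat) (b : R)
    (u : 'I_p -> {RV P >-> R})
    (U : nat -> nat -> {RV P >-> nat})
    (J : nat -> {RV P >-> nat})
    (p_prime : prime p) (b_gt0 : 0 < b) (b_lt1 : b < 1)
    (u_sum0 : {ae P, forall w, \sum_(s < p) u s w = 0})
    (U_uniform : forall k j : nat, U_index p (k, j) ->
       uniform_below P (p ^ k.+1) (U k j))
    (U_indep : mutually_independent P (U_index p)
       (fun (kj : nat * nat) (w : T) => U kj.1 kj.2 w))
    (U_indep_u : independent_systems P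
       (sigma_gen (U_index p) (fun (kj : nat * nat) (w : T) => U kj.1 kj.2 w))
       (sigma_gen setT (fun (s : 'I_p) (w : T) => u s w)))
    (J_uniform : forall k : nat, uniform_below P (p ^ k.+1) (J k))
    (J_indep : mutually_independent P setT (fun (k : nat) (w : T) => J k w))
    (J_indep_uU : independent_systems P
       (sigma_gen setT (fun (k : nat) (w : T) => J k w))
       <<s sigma_gen setT (fun (s : 'I_p) (w : T) => u s w) `|`
           sigma_gen (U_index p)
             (fun (kj : nat * nat) (w : T) => U kj.1 kj.2 w) >>) :
  let H : R := - (ln b / ln p%:R) in
  dt_ss_si P
    (X b (fun s w => u s w) (fun k j w => U k j w) (fun k w => J k w))
    (fun n : nat => padic_norm R p n `^ H).
Proof.
have p_gt0 := prime_gt0 p_prime; have p_gt1 := prime_gt1 p_prime.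
pose S := sample u U J.
have joint B C L (mB : forall s, measurable (B s)) :=
  joint_block_law p_prime U_uniform U_indep U_indep_u
    J_uniform J_indep J_indep_uU C L mB.
have mS e tau : measurable_fun setT (S e tau).
  exact: measurable_sample.
have mW n : measurable_fun setT (@walk R p b n) by exact: measurable_walk.
have mX : process
    (X b (fun s w => u s w) (fun k j w => U k j w) (fun k w => J k w)).
  move=> n; rewrite (funext (X_walk b u U J n)).
  exact: (measurableT_comp (mW n) (mS _ _)).
move=> H; rewrite /H; split.
- exact: mX.
- by move=> n n0; rewrite padic_norm_powR// exprn_gt0.
- move=> n n0; rewrite padic_norm_powR//.
  set e := logn p n; pose q := (n`_p^')%N.
  have nE : n = (p ^ e * q)%N by rewrite -p_part partnC.
  have pq : coprime p q by rewrite (pnat_coprime (pnat_id p_prime) (part_pnat _ _)).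
  pose tau k (z : nat * nat) := ((z.1 * q) %% p ^ k.+1, z.2 %/ p ^ e)%N.
  have mF m :
      measurable_fun setT (fun x : data R p => b ^+ e * walk b m x).
    exact: measurable_funM.
  move=> A sA.
  transitivity (P [set w | A (fun m => b ^+ e * walk b m (S e tau w))]).
    apply: eq_in_distribution_ae sA.
    + by move=> m; exact: mX.
    + by move=> m; exact: (measurableT_comp (mF m) (mS _ _)).
    + apply: filterS2 u_sum0 (ae_J_lt p_gt0 J_uniform) => w u0 Jw.
      apply/funext => m; rewrite X_walk nE walk_dilate//=; last first.
        by move=> k; rewrite addn0.
      congr (_ * walk _ _ (_, _)); apply/funext => k.
      by rewrite addn0.
  rewrite (sample_invariant p_prime joint (e := e) (tau := tau)
    (F := fun m (x : data R p) => b ^+ e * walk b m x))//.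
    congr (P _); apply/funext => w /=; congr (A _); apply/funext => m.
    by rewrite X_walk.
  move=> k C; rewrite addnC -addnS expnD; apply: square_law_fold.
  + by rewrite expn_gt0 p_gt0.
  + by rewrite expn_gt0 p_gt0.
  + exact: coprimeXl.
- move=> k _ A sA.
  pose tau l (z : nat * nat) := (z.1, (z.2 + z.1 * k) %% p ^ l.+1)%N.
  pose F m (x : data R p) := walk b m.+1 x - walk b m x.
  have mF m : measurable_fun setT (F m) by exact: measurable_funB.
  transitivity (P [set w | A (fun m => F m (S 0 (fun=> id) w))]).
    congr (P _); apply/funext => w /=; congr (A _); apply/funext => m.
    by rewrite !X_walk.
  rewrite -(sample_invariant p_prime joint (e := 0%N) (tau := tau) (F := F))//.
    congr (P _); apply/funext => w /=; congr (A _); apply/funext => m.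
    rewrite !X_walk -addSn !(addnC _ k) /F.
    set x := sample _ _ _ 0 (fun=> id) w.
    have xE i : walk b i (S 0%N tau w) = walk b (k + i) x - walk b k x.
      by rewrite walk_shift.
    by rewrite !xE opprB addrA subrK.
  by move=> l C; rewrite addn0; exact: (square_law_shift R _ (fun j => j * k)%N).
Qed.
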